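(* A finite group $G$ is strongly supersoluble if and only if $G$ is metanilpotent and every Sylow subgroup of $G$ is submodular in $G$.
   Context: All groups are finite. A subgroup $M$ of a group $G$ is called modular in $G$ if: (1) $\langle X, M\cap Z\rangle=\langle X,M\rangle\cap Z$ for all $X\le G$, $Z\le G$ with $X\le Z$; and (2) $\langle M, Y\cap Z\rangle=\langle M,Y\rangle\cap Z$ for all $Y\le G$, $Z\le G$ with $M\le Z$. A subgroup $H$ of $G$ is called submodular in $G$ if there is a chain of subgroups $H=H_0\le H_1\le\dots\le H_s=G$ such that $H_{i-1}$ is modular in $H_i$ for $i=1,\dots,s$. A group is called strongly supersoluble if it is supersoluble and every Sylow subgroup of it is submodular in it. A group is metanilpotent if it has a nilpotent normal subgroup with nilpotent quotient. *)

(* Defs.v *)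
From mathcomp Require Import all_boot all_fingroup all_solvable.

Set Implicit Arguments.
Unset Strict Implicit.
Unset Printing Implicit Defensive.

Local Open Scope group_scope.

Section Defs.

Variable gT : finGroupType.
Implicit Types (M H G U V : {set gT}).

(* Modular element of the subgroup lattice of G, in the sense of Kurosh; this
   is a condition on the embedding of M in G, unrelated to the modular
   p-groups 'Mod_m of extremal.v. *)
Definition modular_in M G :=
  [&& M \subset G,
      [forall X : {group gT}, forall Z : {group gT},
         [&& X \subset G, Z \subset G & X \subset Z] ==>
           (X <*> (M :&: Z) == (X <*> M) :&: Z)]
    & [forall Y : {group gT}, forall Z : {group gT},
         [&& Y \subset G, Z \subset G & M \subset Z] ==>
           (M <*> (Y :&: Z) == (M <*> Y) :&: Z)]].

Definition submodular (H G : {group gT}) :=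
  exists2 s : seq {group gT}, modular_in.-series H s & last H s = G.

Definition cyclic_normal_factor G V U :=
  [&& V <| G, U <| G, V \subset U & cyclic (U / V)].

Definition supersoluble (G : {group gT}) :=
  exists2 s : seq {group gT},
    (cyclic_normal_factor G).-series 1%G s & last 1%G s = G.

Definition metanilpotent (G : {group gT}) :=
  exists N : {group gT}, [/\ N <| G, nilpotent N & nilpotent (G / N)].

Definition sylow_submodular (G : {group gT}) :=
  forall (p : nat) (P : {group gT}),
    prime p -> p.-Sylow(G) P -> submodular P G.

Definition strongly_supersoluble (G : {group gT}) :=
  supersoluble G /\ sylow_submodular G.

End Defs.

(* Main.v *)
(* If G is supersoluble, G^`(1) centralises the cyclic factors of a normal series
   of G, hence is nilpotent.  Conversely, let U be a minimal normal subgroup of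
   G (or of a quotient of G, as both hypotheses pass to quotients).
   Submodularity makes each Sylow subgroup Q of G normalise a subgroup W of
   prime order of U.  Then Q^`(1) centralises W, and minimality spreads this to
   all of U, because G / 'C_G(U) is nilpotent; hence G / 'C_G(U) is abelian.  So
   the eigenspaces in U of an element of Q are normal in G, whence Q acts on U
   by power automorphisms; thus G normalises every subgroup of U, and U is
   cyclic. *)
Require Import Defs.
From mathcomp Require Import all_boot all_fingroup all_solvable.

Set Implicit Arguments.
Unset Strict Implicit.
Unset Printing Implicit Defensive.

Local Open Scope group_scope.

(** * Modular and submodular subgroups acting on normal subgroups *)

Section Modular.

Variable gT : finGroupType.
Implicit Types G H K M Q U V W X Y Z : {group gT}.

Lemma modular_inP (M H : {set gT}) :
  reflect [/\ M \subset H,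
    forall X Z, X \subset H -> Z \subset H -> X \subset Z ->
      X <*> (M :&: Z) = (X <*> M) :&: Z
    & forall Y Z : {group gT}, Y \subset H -> Z \subset H -> M \subset Z ->
      M <*> (Y :&: Z) = (M <*> Y) :&: Z] (modular_in M H).
Proof.
apply: (iffP and3P) => [[sMH /forallP m1 /forallP m2] | [sMH m1 m2]]; split=> //.
- move=> X Z sXH sZH sXZ; have /forallP/(_ Z) := m1 X.
  by rewrite sXH sZH sXZ => /eqP.
- move=> Y Z sYH sZH sMZ; have /forallP/(_ Z) := m2 Y.
  by rewrite sYH sZH sMZ => /eqP.
- apply/forallP=> X; apply/forallP=> Z; apply/implyP=> /and3P[sXH sZH sXZ].
  by rewrite m1.
- apply/forallP=> Y; apply/forallP=> Z; apply/implyP=> /and3P[sYH sZH sMZ].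
  by rewrite m2.
Qed.

Lemma submodular_sub M G : submodular M G -> M \subset G.
Proof.
case=> s; elim: s M => [|H s IHs] M /= => [_ -> //|/andP[/modular_inP[sMH _ _]]].
by move=> s_ser lastG; apply: subset_trans sMH (IHs H s_ser lastG).
Qed.

(** Condition (1) with [X := W] and [Z := U] reads [W = (W <*> M) :&: U], and [M] normalises both
    groups on the right. *)
Lemma modular_norm_TI M H U W :
    modular_in M H -> U <| H -> M :&: U = 1 -> W \subset U ->
  M \subset 'N(W).
Proof.
case/modular_inP=> sMH modM _ nsUH tiMU sWU.
have sWH := subset_trans sWU (normal_sub nsUH).
have := modM W U sWH (normal_sub nsUH) sWU; rewrite tiMU joingG1 => ->.
rewrite normsI ?(subset_trans sMH (normal_norm nsUH)) //.
by rewrite (subset_trans (joing_subr W M)) ?normG.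
Qed.

(* Along the chain from Q to G, consider the first term H meeting U
   nontrivially: the previous term normalises every subgroup of H :&: U. *)
Lemma submodular_norm_prime Q G U :
    submodular Q G -> U <| G -> Q :&: U = 1 -> U :!=: 1 ->
  exists W, [/\ W \subset U, prime #|W| & Q \subset 'N(W)].
Proof.
case=> s; elim: s Q => [|H s IHs] Q /=.
  by move=> _ -> /andP[sUG _]; rewrite (setIidPr sUG) => ->; rewrite eqxx.
case/andP=> modQ s_ser lastG nsUG tiQU ntU.
have sQH: Q \subset H by case/modular_inP: modQ.
have [tiHU | ntHU] := eqVneq (H :&: U) 1.
  have [W [sWU prW nWH]] := IHs H s_ser lastG nsUG tiHU ntU.
  by exists W; split=> //; apply: subset_trans nWH.
have sHG: H \subset G by apply: submodular_sub; exists s.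
have nsHUH: H :&: U <| H.
  by rewrite /normal subsetIl normsI ?normG ?(subset_trans sHG) ?normal_norm.
have [x HUx prx] := Cauchy (pdiv_prime (etrans (cardG_gt1 _) ntHU)) (pdiv_dvd _).
have sxHU: <[x]> \subset H :&: U by rewrite cycle_subG.
exists <[x]>%G; split; first exact: subset_trans sxHU (subsetIr _ _).
  by rewrite -[#|_|]/(#[x]) prx pdiv_prime // cardG_gt1.
apply: (modular_norm_TI modQ nsHUH _ sxHU).
by apply/trivgP; rewrite -tiQU setIS ?subsetIr.
Qed.

End Modular.

(** * Passage of the hypotheses to quotients *)

Section Quotient.

(** The modular laws are applied to preimages and pushed forward: [f] commutes with joins, and with
    an intersection when one member is a full preimage. *)
Lemma modular_in_morphim (aT rT : finGroupType) (H M : {group aT})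
    (f : {morphism H >-> rT}) :
  modular_in M H -> modular_in (f @* M) (f @* H).
Proof.
case/modular_inP=> sMH modX modY.
have fpreK (X : {group rT}) : X \subset f @* H -> f @* (f @*^-1 X) = X.
  exact: morphpreK.
have preH (X : {group rT}) : f @*^-1 X \subset H by apply: subsetIl.
apply/modular_inP; split=> [|X Z sXH sZH sXZ|Y Z sYH sZH sMZ].
- exact: morphimS.
- have sMZH := subset_trans (subsetIr M _) (preH Z).
  rewrite -morphim_setIpre -{1}(fpreK X) // -morphimY // modX ?preH ?morphpreS //.
  by rewrite morphim_setIpre morphimY ?preH //= fpreK.
- have sYZH := subset_trans (subsetIr (f @*^-1 Y) _) (preH Z).
  rewrite -{1}(fpreK Y) // -morphim_setIpre -morphimY // modY ?preH //.
    by rewrite morphim_setIpre morphimY ?preH //= fpreK.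
  by rewrite -sub_morphim_pre.
Qed.

Variables (gT : finGroupType) (K : {group gT}).

Lemma modular_in_quotient (M H : {group gT}) :
  H \subset 'N(K) -> modular_in M H -> modular_in (M / K) (H / K).
Proof.
move=> nKH modM; have sMH: M \subset H by case/modular_inP: modM.
(* The coset morphism is restricted to [H], which must be the whole domain. *)
have := modular_in_morphim (restrm_morphism nKH (coset_morphism K)) modM.
by rewrite !morphim_restrm setIid (setIidPr sMH).
Qed.

Lemma submodular_quotient (H G : {group gT}) :
  G \subset 'N(K) -> submodular H G -> submodular (H / K)%G (G / K)%G.
Proof.
move=> nKG [s]; elim: s H => [|H1 s IHs] H /=.
  by move=> _ ->; exists [::].
case/andP=> modH s_ser lastG.
have sH1G: H1 \subset G by apply: submodular_sub; exists s.
have [t t_ser lastGK] := IHs H1 s_ser lastG.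
exists (H1 / K :: t)%G => //=; rewrite t_ser andbT.
by apply: modular_in_quotient modH; apply: subset_trans nKG.
Qed.

(** By conjugacy, each Sylow subgroup of [G / K] is the image of one of [G]. *)
Lemma sylow_submodular_quotient (G : {group gT}) :
  G \subset 'N(K) -> sylow_submodular G -> sylow_submodular (G / K)%G.
Proof.
move=> nKG smG p P pr_p sylP; have [Q sylQ] := Sylow_exists p G.
have sQG := pHall_sub sylQ.
have sylQK := quotient_pHall (subset_trans sQG nKG) sylQ.
have [_ /morphimP[y nKy Gy ->] defP] := Sylow_trans sylQK sylP.
have ->: P = ((Q :^ y) / K)%G by apply: val_inj; rewrite /= quotientJ.
by apply: submodular_quotient => //; apply: smG pr_p _; rewrite pHallJ.
Qed.

Lemma metanilpotent_quotient (G : {group gT}) :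
  G \subset 'N(K) -> metanilpotent G -> metanilpotent (G / K)%G.
Proof.
move=> nKG [N [nsNG nilN nilGN]]; exists (N / K)%G.
split; [exact: quotient_normal | exact: quotient_nil |].
have nNG := normal_norm nsNG; have nKN := subset_trans (normal_sub nsNG) nKG.
(* Nilpotency of [G / N] puts ['L_n.+1(G)] inside [N], and this inclusion survives modulo [K]. *)
have /lcnP[n LGN1] := nilGN; apply/lcnP; exists n.
rewrite -!morphim_lcn ?quotient_norms //.
apply: quotientS1; rewrite quotientS // -quotient_sub1.
  by rewrite /quotient morphim_lcn // LGN1.
exact: subset_trans (lcn_sub _ _) nNG.
Qed.

End Quotient.

(** * Reduction to Sylow subgroups *)

Lemma Sylow_gen_subG (gT : finGroupType) (G H : {group gT}) :
  (forall p (P : {group gT}), prime p -> p.-Sylow(G) P -> P \subset H) -> G \subset H.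
Proof.
move=> sPH; rewrite -(Sylow_gen G) gen_subG; apply/bigcupsP=> P.
by case/SylowP=> p pr_p; apply: sPH.
Qed.

Lemma nilpotent_Sylow_abelian (gT : finGroupType) (G : {group gT}) :
    nilpotent G -> (forall p (P : {group gT}), prime p -> p.-Sylow(G) P -> abelian P) ->
  abelian G.
Proof.
move=> nilG abP; apply: Sylow_gen_subG => p P pr_p sylP.
rewrite centsC; apply: Sylow_gen_subG => q Q pr_q sylQ.
have [eq_pq | neq_pq] := eqVneq p q.
  rewrite eq_pq in sylP; rewrite (nilpotent_Hall_pcore nilG sylP).
  by rewrite -(nilpotent_Hall_pcore nilG sylQ); apply: abP sylQ.
apply: sub_nilpotent_cent2 nilG (pHall_sub sylP) (pHall_sub sylQ) _.
apply: pnat_coprime (pHall_pgroup sylP) _; apply: pi_pnat (pHall_pgroup sylQ) _.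
by rewrite !inE eq_sym.
Qed.

(** * Action on a minimal normal subgroup *)

Section Minnormal.

Variable gT : finGroupType.
Implicit Types A G N P Q U W : {group gT}.

Lemma cyclic_der1_cent W Q : cyclic W -> Q \subset 'N(W) -> Q^`(1) \subset 'C(W).
Proof.
move=> cycW nWQ; rewrite -ker_conj_aut ker_trivg_morphim.
rewrite (subset_trans (der_sub 1 Q)) //= morphim_der //.
by apply/trivgP/derG1P/(abelianS (Aut_conj_aut _ _))/Aut_cyclic_abelian.
Qed.

Lemma minnormal_sub_eq U G W :
  minnormal U G -> W \subset U -> W :!=: 1 -> G \subset 'N(W) -> W :=: U.
Proof.
by case/mingroupP=> _ minU sWU ntW nWG; rewrite (minU W) // ntW.
Qed.

(** If [U :&: N] is trivial, it contains [[~: U, N]]. Otherwise minimality gives first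
    [U \subset N], then [U \subset 'Z(N)], since [U] meets the centre of the nilpotent group [N]. *)
Lemma nilpotent_minnormal_cent N U G :
  minnormal U G -> U \subset G -> N <| G -> nilpotent N -> N \subset 'C(U).
Proof.
move=> minU sUG nsNG nilN; have [/andP[ntU nUG] _] := mingroupP minU.
have nNG := normal_norm nsNG; have sNG := normal_sub nsNG.
have [tiUN | ntUN] := eqVneq (U :&: N) 1.
  rewrite centsC; apply/commG1P/trivgP; rewrite -tiUN.
  by rewrite commg_subI // subsetI subxx ?(subset_trans sNG) ?(subset_trans sUG).
have /setIidPl sUN: U :&: N = U.
  by apply: (minnormal_sub_eq minU _ ntUN); rewrite /= ?subsetIl ?normsI.
have nsUN: U <| N by rewrite /normal sUN (subset_trans sNG).
have ntUZ := meet_center_nil nilN nsUN ntU.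
have nZG: G \subset 'N('Z(N)) by rewrite (char_norm_trans (center_char N)).
have /setIidPl sUZ: U :&: 'Z(N) = U.
  apply: (minnormal_sub_eq minU _ ntUZ); first exact: subsetIl.
  exact: normsI nUG nZG.
by rewrite centsC (subset_trans sUZ) ?subsetIr.
Qed.

(* A and A * 'C_G(U) have the same centraliser in U, and the latter group is
   normal in G. *)
Lemma minnormal_cent_of_fix A U G :
    minnormal U G -> A \subset G -> A / 'C_G(U) <| G / 'C_G(U) ->
  'C_U(A) != 1 -> A \subset 'C(U).
Proof.
move=> minU sAG nsAC ntCUA; have [/andP[ntU nUG] _] := mingroupP minU.
have nsCG: 'C_G(U) <| G.
  by rewrite /normal subsetIl normsI ?normG ?norms_cent.
have nCA := subset_trans sAG (normal_norm nsCG).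
have [B /= defAB sCB nsBG] := inv_quotientN nsCG nsAC.
have sAB : A \subset B by rewrite -(quotientSGK nCA sCB) defAB.
have sBCA : B \subset 'C_G(U) * A.
  by rewrite -quotientSK ?defAB // (subset_trans (normal_sub nsBG)) ?normal_norm.
have eqCU : 'C_U(A) = 'C_U(B).
  apply/eqP; rewrite eqEsubset andbC setIS ?centS //= subsetI subsetIl /=.
  rewrite centsC (subset_trans sBCA) // mul_subG //.
    by rewrite (subset_trans (subsetIr _ _)) // centS ?subsetIl.
  by rewrite centsC subsetIr.
rewrite centsC; apply/setIidPl.
apply: (minnormal_sub_eq minU _ ntCUA); rewrite /= ?subsetIl // eqCU.
by rewrite normsI // norms_cent ?normal_norm.
Qed.

(* If w ^ x = w ^+ k, the elements u of U with u ^ x = u ^+ k form a subgroup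
   normalised by G, because x is central in G modulo 'C(U). *)
Lemma minnormal_eigen U G w x :
    minnormal U G -> abelian U -> x \in G -> [~: G, G] \subset 'C(U) ->
    w \in U -> w != 1 -> x \in 'N(<[w]>) ->
  forall W, W \subset U -> x \in 'N(W).
Proof.
move=> minU abU Gx cUG' Uw ntw nwx W sWU.
have [/andP[ntU nUG] _] := mingroupP minU.
have /cycleP[k wx]: w ^ x \in <[w]> by rewrite memJ_norm ?cycle_id.
pose E := [set u in U | u ^ x == u ^+ k].
have gE: group_set E.
  apply/group_setP; split=> [|u v]; first by rewrite inE group1 conj1g expg1n /=.
  rewrite !inE => /andP[Uu /eqP ux] /andP[Uv /eqP vx].
  by rewrite groupM //= conjMg ux vx expgMn //; apply: (centsP abU).
have sEU: E \subset U by apply/subsetP=> u; rewrite inE => /andP[].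
have ntE: Group gE :!=: 1.
  by apply/trivgPn; exists w; rewrite // inE Uw wx /=.
have nEG: G \subset 'N(E).
  apply/subsetP=> g Gg; rewrite inE; apply/subsetP=> _ /imsetP[u + ->].
  rewrite !inE => /andP[Uu /eqP ux].
  have nUg := subsetP nUG g Gg; have nUx := subsetP nUG x Gx.
  have cgx: [~ g, x] \in 'C(U) by rewrite (subsetP cUG') ?mem_commg.
  (* Here [g * x = x * g * [~ g, x]], and the commutator fixes [u ^ g]. *)
  rewrite memJ_norm // Uu -conjgM commgC conjgM conjgM ux conjXg conjXg /=.
  by rewrite [_ ^ [~ g, x]]conjgE -(centP cgx) ?mulKg // memJ_norm.
have defE: E = U := @minnormal_sub_eq U G (Group gE) minU sEU ntE nEG.
rewrite inE; apply/subsetP=> _ /imsetP[u Wu ->].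
have: u \in E by rewrite defE (subsetP sWU).
by rewrite inE => /andP[_ /eqP->]; rewrite groupX.
Qed.

(** Let [U] be a [p]-group. For [q != p], [Q] meets [U] trivially and submodularity applies; for
    [q = p], [Q] contains [U] and centralises a subgroup of prime order in [U :&: 'Z(Q)]. *)
Lemma Sylow_norm_prime G U :
    sylow_submodular G -> U <| G -> is_abelem U -> U :!=: 1 ->
    forall q Q, prime q -> q.-Sylow(G) Q ->
  exists W, [/\ W \subset U, prime #|W| & Q \subset 'N(W)].
Proof.
move=> smG nsUG /is_abelemP[p pr_p abelU] ntU q Q pr_q sylQ.
have pU := abelem_pgroup abelU.
have [eq_qp | neq_qp] := eqVneq q p; last first.
  apply: submodular_norm_prime (smG q Q pr_q sylQ) nsUG _ ntU.
  apply: coprime_TIg; apply: pnat_coprime (pHall_pgroup sylQ) _.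
  by apply: pi_pnat pU _; rewrite !inE eq_sym.
rewrite eq_qp in sylQ; have sQG := pHall_sub sylQ.
have sUQ: U \subset Q.
  by rewrite (subset_trans (pcore_max pU nsUG)) // pcore_sub_Hall.
have nsUQ : U <| Q by rewrite (normalS sUQ sQG).
have ntUZ := meet_center_nil (pgroup_nil (pHall_pgroup sylQ)) nsUQ ntU.
have [x] := Cauchy (pdiv_prime (etrans (cardG_gt1 _) ntUZ)) (pdiv_dvd _).
case/setIP=> Ux /setIP[_ cQx] ox; exists <[x]>%G; split.
- by rewrite cycle_subG.
- by rewrite -[#|_|]/(#[x]) ox pdiv_prime // cardG_gt1.
- by rewrite cents_norm // centsC cycle_subG.
Qed.

Lemma minnormal_cyclic G U :
    metanilpotent G -> sylow_submodular G -> minnormal U G -> U \subset G ->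
  cyclic U.
Proof.
move=> [N [nsNG nilN nilGN]] smG minU sUG.
have solG: solvable G.
  by rewrite (series_sol nsNG) (nilpotent_sol nilN) nilpotent_sol.
have [nUG ntU abelU] := minnormal_solvable minU sUG solG.
have nsUG: U <| G by apply/andP.
have abU : abelian U by case/is_abelemP: abelU => p _ /abelem_abelian.
have normW := Sylow_norm_prime smG nsUG abelU ntU.
set C := 'C_G(U).
have nsCG: C <| G by rewrite /normal subsetIl normsI ?normG ?norms_cent.
have nCG := normal_norm nsCG.
have sNC: N \subset C.
  by rewrite subsetI normal_sub //= (nilpotent_minnormal_cent minU).
have nilGC: nilpotent (G / C).
  have [f <-] := homgP (homg_quotientS (normal_norm nsNG) nCG sNC).
  exact: morphim_nil.
have abGC: abelian (G / C).
  apply: nilpotent_Sylow_abelian => // q P pr_q sylP.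
  have [Q sylQ] := Sylow_exists q G; have sQG := pHall_sub sylQ.
  have nCQ := subset_trans sQG nCG.
  have sylQC := quotient_pHall nCQ sylQ.
  rewrite (nilpotent_Hall_pcore nilGC sylP) -(nilpotent_Hall_pcore nilGC sylQC).
  have [W [sWU prW nWQ]] := normW q Q pr_q sylQ.
  (* The derived subgroup of [Q] fixes [W] pointwise. Its image is characteristic in a Sylow
     subgroup of the nilpotent group [G / C], hence normal, so it centralises all of [U]. *)
  apply: sub_der1_abelian; rewrite subsetI (subset_trans (der_sub 1 Q)) //=.
  apply: minnormal_cent_of_fix minU _ _ _.
  - exact: subset_trans (der_sub 1 Q) sQG.
  - rewrite quotient_der // (char_normal_trans (der_char 1 _)) //.
    by rewrite (nilpotent_Hall_pcore nilGC sylQC) pcore_normal.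
  have cWQ := cyclic_der1_cent (prime_cyclic prW) nWQ.
  apply: contraTneq prW => tiC.
  have: W \subset [1] by rewrite -tiC subsetI sWU centsC.
  by move/trivgP->; rewrite cards1.
have cUG': [~: G, G] \subset 'C(U).
  have: [~: G, G] \subset C by rewrite -quotient_cents2.
  by move/subset_trans->; rewrite ?subsetIr.
(* Any [x] of prime order in [U] will do: a generator [w] of [W] is an eigenvector of each [y] in
   [Q], so [y] normalises every subgroup of [U]. *)
have [x Ux ox] := Cauchy (pdiv_prime (etrans (cardG_gt1 _) ntU)) (pdiv_dvd _).
have nxG: G \subset 'N(<[x]>).
  apply: Sylow_gen_subG => q Q pr_q sylQ; apply/subsetP=> y Qy.
  have [W [sWU prW nWQ]] := normW q Q pr_q sylQ.
  have /cyclicP[w defW] := prime_cyclic prW.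
  apply: (@minnormal_eigen U G w) => //; rewrite ?cycle_subG //.
  - by rewrite (subsetP (pHall_sub sylQ)).
  - by rewrite (subsetP sWU) // defW cycle_id.
  - by apply: contraTneq prW; rewrite defW => ->; rewrite cycle1 cards1.
  - by rewrite -defW (subsetP nWQ).
apply/cyclicP; exists x.
apply/esym/(minnormal_sub_eq minU _ _ nxG); rewrite /= ?cycle_subG //.
by rewrite cycle_eq1 -order_gt1 ox prime_gt1 ?pdiv_prime ?cardG_gt1.
Qed.

End Minnormal.

(** * The two implications *)

Lemma supersoluble_metanilpotent (gT : finGroupType) (G : {group gT}) :
  supersoluble G -> metanilpotent G.
Proof.
case=> s s_ser lastG; exists G^`(1)%G; split; first exact: der_normal.
  apply/forall_inP=> H; rewrite subsetI => /andP[sHG sH].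
  (* By definition of [nilpotent], [H] must be shown trivial. It descends the series from [G] to
     [1]: if [H] lies in [U], then [[~: H, G']], with [G'] the derived subgroup, lies in [V], as
     [U / V] is cyclic. *)
  suffices: forall V : {group gT},
      (cyclic_normal_factor G).-series V s -> H \subset last V s -> H \subset V.
    move/(_ 1%G s_ser); rewrite lastG (subset_trans sHG) ?der_sub //.
    by move=> /(_ isT) /trivgP->.
  elim: s {s_ser lastG} => //= U s IHs V /andP[/and4P[nsVG nsUG sVU cycUV] s_ser].
  move/(IHs U s_ser) => sHU; apply: subset_trans sH _.
  have [nVG nUG] := (normal_norm nsVG, normal_norm nsUG).
  apply: subset_trans (commSg _ sHU) _; rewrite -quotient_cents2.
  - by rewrite centsC quotient_der // cyclic_der1_cent // quotient_norms.
  - exact: subset_trans (normal_sub nsUG) nVG.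
  - exact: subset_trans (der_sub 1 G) nVG.
exact: abelian_nil (der_abelian 0 G).
Qed.

Theorem theorem2p9 (gT : finGroupType) (G : {group gT}) :
  strongly_supersoluble G <-> metanilpotent G /\ sylow_submodular G.
Proof.
split=> [[ssG smG] | [mnG smG]]; split=> //.
  exact: supersoluble_metanilpotent.
(* A chief series serves: each factor [U / V] is minimal normal in [G / V], hence cyclic. *)
have [s s_ser lastG] := chief_series_exists (normal_refl G).
exists s => //; apply: sub_path s_ser => V U /= chUV.
have /andP[/maxgroupP[/andP[/andP[sVU _] nVG] _] nsUG] := chUV.
have sVG := subset_trans sVU (normal_sub nsUG).
apply/and4P; split=> //; first exact/andP.
apply: (@minnormal_cyclic _ (G / V)%G (U / V)%G).
- exact: metanilpotent_quotient.
- exact: sylow_submodular_quotient.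
- exact: chief_factor_minnormal.
- by rewrite quotientS ?normal_sub.
Qed.
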